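(* Let $k\ge 3$ and $n\ge k+1$. If $(G,\mathcal{X})$ is a $k$-ordered graph on $n$ vertices, then $G$ contains cycles of at least $\frac{\log_2 n}{3+\log_2 k}-2$ distinct lengths.
   Context: Let $G$ be a graph on $n$ vertices and $\mathcal{X}=x_1,\dots,x_n$ an ordering of $V(G)$. Write $d^+(x_i)=|\{x_j\in N_G(x_i):j>i\}|$ and $d^-(x_i)=|\{x_j\in N_G(x_i):j<i\}|$. The pair $(G,\mathcal{X})$ is a $k$-ordered graph if (1) $x_{n-1}x_n\in E(G)$; (2) $d^+(x_i)\in[2,k]$ for all $1\le i\le n-2$; and (3) $d^-(x_i)\ge 1$ for all $2\le i\le n$. The length of a cycle is its number of edges. *)

(* Defs.v *)
From HB Require Import structures.
From mathcomp Require Import all_boot all_order all_algebra.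
From mathcomp Require Import reals exp.
Set Implicit Arguments.
Unset Strict Implicit.
Unset Printing Implicit Defensive.
Import Order.TTheory GRing.Theory Num.Theory.

(* A graph is a symmetric irreflexive relation [e] on a finType [V]; an ordering
   of its vertices is a bijection [x : 'I_n -> V].  Indices are shifted by one:
   [x i] is the vertex usually written x_(i+1). *)

Section OrderedGraph.

Variables (V : finType) (e : rel V) (n : nat) (x : 'I_n -> V).

Definition dplus (i : 'I_n) : nat := #|[set x j | j : 'I_n & e (x i) (x j) && (i < j)]|.

Definition dminus (i : 'I_n) : nat := #|[set x j | j : 'I_n & e (x i) (x j) && (j < i)]|.

Record k_ordered (k : nat) : Prop := KOrdered {
  k_ordered_last : exists i j : 'I_n, [/\ i.+2 = n, j.+1 = n & e (x i) (x j)];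
  k_ordered_dplus : forall i : 'I_n, i.+2 < n -> 2 <= dplus i <= k;
  k_ordered_dminus : forall i : 'I_n, 0 < i -> 1 <= dminus i
}.

End OrderedGraph.

(* [ucycle e c] alone also admits lists [c] with fewer than three vertices. *)
Definition has_cycle_length (V : finType) (e : rel V) (l : nat) : Prop :=
  exists c : seq V, [/\ ucycle e c, 3 <= size c & size c = l].

Definition log2 (R : realType) (a : R) : R := (ln a / ln 2)%R.

(* Main.v *)
(* Orient every edge forward; let h(v) and lam(v) be the lengths of the longest
   forward paths out of v and into v, and H the height of the first vertex.

   Tall case. Two forward paths started at the two children of v and advanced
   at their higher endpoint stay disjoint until they reach the last edge, which
   closes a cycle of length in [h(v)+1, 2h(v)+1]. Heights 2, 5, 11, 23, ... give
   disjoint intervals, so t lengths force H+1 < 3 * 2^t.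

   Wide case. Let S be the vertices with lam = a and h = c. Following longest
   paths backward (par) and forward (succ) from two vertices of S until they
   meet gives a cycle of length 2(D+J), where D and J are the meeting times.
   Some pair has both D and J maximal, and passing to the largest of the at most
   k branches at the top decreases D, so this longest length disappears. Hence t
   lengths force |S| < k^(t+1).

   As a + c <= H there are at most (H+1)^2 classes S, whence
   n <= 9 * 4^t * k^(t+1) <= (8k)^(t+2). *)
Require Import Defs.
From HB Require Import structures.
From mathcomp Require Import all_boot all_order all_algebra.
From mathcomp Require Import reals exp.
From mathcomp Require Import zify.
Import Order.TTheory GRing.Theory Num.Theory.

Set Implicit Arguments.
Unset Strict Implicit.
Unset Printing Implicit Defensive.

(** * Longest paths, cycles from two paths, and pigeonhole tools *)

Lemma exists_height (V : finType) (f : rel V) (r : V -> nat) :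
  (forall u v, f u v -> r v < r u) ->
  exists (h : V -> nat) (s : V -> V),
    (forall u v, f u v -> h v < h u) /\
    (forall u, 0 < h u -> f u (s u) /\ h u = (h (s u)).+1).
Proof.
move=> rP.
(* [H m u] is the greatest length of an [f]-path from [u] with at most [m] edges; [r u] is always
   enough fuel. *)
pose H := fix H m u :=
  if m is m'.+1 then \max_(v | f u v) (H m' v).+1 else 0.
have HE m u : r u <= m -> H m u = H (r u) u.
  have [p] := ubnP (r u); elim: p u m => // p IH u m lt_p.
  have no_child : r u = 0 -> f u =1 pred0.
    by move=> r0 v; apply/negP => /rP; rewrite r0.
  case: m => [|m]; first by rewrite leqn0 => /eqP ->.
  case r_u: (r u) => [|q] le_m /=; first by rewrite big_pred0 //; apply: no_child.
  apply: eq_bigr => v /rP; rewrite r_u => lt_v.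
  by rewrite (IH _ m) ?(IH _ q) //; lia.
pose h u := H (r u) u.
have hE u : h u = \max_(v | f u v) (h v).+1.
  rewrite -[h u](HE (r u).+1) //=; apply: eq_bigr => v /rP lt_v.
  by rewrite HE // ltnW.
exists h, (fun u => odflt u [pick v | f u v && (h u == (h v).+1)]); split.
  by move=> u v fuv; rewrite [h u]hE (@leq_bigmax_cond _ _ (fun v => (h v).+1) _ fuv).
move=> u h_gt0; case: pickP => [v /andP[fuv /eqP] //|none].
have [v0 fuv0|no_child] := pickP (f u).
  have /(@eq_bigmax_cond _ (f u) (fun v => (h v).+1))[v fuv] : 0 < #|f u|.
    by apply/card_gt0P; exists v0.
  rewrite -(hE u) => hv.
  by have := none v; rewrite hv eqxx andbT => /negP[].
by move: h_gt0; rewrite hE big_pred0.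
Qed.

(** Traverse [P], cross to the end of [Q] and return along [Q] reversed. *)
Lemma cycle_of_two_paths (V : finType) (e : rel V) (v : V) (P Q : seq V) :
  symmetric e -> P != [::] -> Q != [::] ->
  path e v P -> path e v Q -> e (last v P) (last v Q) ->
  uniq (v :: P ++ Q) -> has_cycle_length e (size P + size Q).+1.
Proof.
move=> e_sym P0 Q0 eP eQ ePQ uPQ; exists (v :: P ++ rev Q).
rewrite /= size_cat size_rev; split=> //; last first.
  by case: P P0 {eP ePQ uPQ} => [|? ?] //; case: Q Q0 {eQ} => [|? ?] //=; lia.
apply/andP; split; last first.
  rewrite (perm_uniq (s2 := v :: P ++ Q)) //.
  by rewrite perm_cons perm_cat2l perm_rev.
rewrite /= rcons_cat cat_path eP /=.
case/lastP: Q Q0 eQ ePQ {uPQ} => // Q z _ eQ.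
rewrite last_rcons rev_rcons /= => ->.
have := rev_path e v (rcons Q z).
rewrite last_rcons belast_rcons rev_cons => ->.
by rewrite (eq_path (e' := e)) // => a b; rewrite e_sym.
Qed.

Lemma path_map_iota (V : Type) (e : rel V) (f : nat -> V) i m :
  (forall j, i <= j < i + m -> e (f j) (f j.+1)) ->
  path e (f i) [seq f j | j <- iota i.+1 m].
Proof.
elim: m i => // m IH i ef /=; rewrite ef ?IH //; last by lia.
by move=> j ij; apply: ef; lia.
Qed.

Lemma last_map_iota (V : Type) (f : nat -> V) i m :
  last (f i) [seq f j | j <- iota i.+1 m] = f (i + m).
Proof. by elim: m i => [|m IH] i /=; rewrite ?addn0 // IH addSnnS. Qed.

Lemma large_fiber (V W : finType) (f : V -> W) (S : {set V}) :
  0 < #|S| ->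
  exists w, #|S| <= #|f @: S| * #|[set u in S | f u == w]|.
Proof.
case/card_gt0P=> u0 Su0.
case: (@arg_maxnP _ (f u0) predT (fun w => #|[set u in S | f u == w]|)) => // w _ wmax.
exists w; rewrite -sum_nat_const -sum1_card (partition_big_imset f) /=.
apply: leq_sum => w' _; apply: leq_trans (wmax w' isT).
by rewrite -sum1_card; apply: eq_leq; apply: eq_bigl => u; rewrite inE.
Qed.

(** If [g] identifies [u] and [v], take [z] in [S] with another value of [g]; since [f u] and [f v]
    differ, [f z] differs from one of them. *)
Lemma jointly_separated (V A B : eqType) (S : pred V) (f : V -> A) (g : V -> B)
    u v u' v' :
  S u -> S v -> f u != f v -> S u' -> S v' -> g u' != g v' ->
  exists y z, [/\ S y, S z, f y != f z & g y != g z].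
Proof.
move=> Su Sv fuv Su' Sv' guv'.
have [guv|] := eqVneq (g u) (g v); last by exists u, v.
have [z Sz guz] : exists2 z, S z & g u != g z.
  have [guu'|] := eqVneq (g u) (g u'); last by exists u'.
  by exists v' => //; rewrite guu'.
have [fuz|] := eqVneq (f u) (f z); last by exists u, z.
by exists v, z; split=> //; rewrite -?guv // -fuz eq_sym.
Qed.

(** Merged orbits stay merged, so [d.+1] is the meeting time of a pair that merges last. *)
Lemma least_collapse (V : finType) (s : V -> V) (S : {set V}) m :
  1 < #|S| -> {in S &, forall u v, iter m s u = iter m s v} ->
  exists d, [/\ d < m, {in S &, forall u v, iter d.+1 s u = iter d.+1 s v} &
    exists u v, [/\ u \in S, v \in S & iter d s u != iter d s v]].
Proof.
case/card_gt1P=> u [v [Su Sv uv]]; elim: m => [|m IH] Sm.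
  by move: uv; rewrite (Sm u v Su Sv : u = v) eqxx.
have [/forall_inP same|] :=
    boolP [forall u in S, [forall v in S, iter m s u == iter m s v]].
  have [|d [lt_d Sd sep]] := IH; last by exists d; split=> //; apply: ltnW.
  by move=> a b Sa Sb; apply/eqP; move/forall_inP: (same a Sa); apply.
case/forall_inPn=> a Sa /forall_inPn[b Sb ab].
by exists m; split=> //; exists a, b.
Qed.

(** * Descent along longest paths *)

Section HeightedDigraph.

Variables (V : finType) (e fwd : rel V) (h : V -> nat) (succ : V -> V).
Hypothesis e_sym : symmetric e.
Hypothesis fwd_edge : forall u v, fwd u v -> e u v.
Hypothesis h_lt : forall u v, fwd u v -> h v < h u.
Hypothesis succP : forall u, 0 < h u -> fwd u (succ u) /\ h u = (h (succ u)).+1.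

Lemma iter_succ j u : j <= h u -> h (iter j succ u) = h u - j.
Proof.
elim: j => [|j IH] lt_j; first by rewrite subn0.
have hj := IH (ltnW lt_j).
by have [] := @succP (iter j succ u); rewrite hj /=; lia.
Qed.

Lemma iter_succ_fwd j u : j < h u -> fwd (iter j succ u) (iter j.+1 succ u).
Proof.
by move=> lt_j; have [] := @succP (iter j succ u); rewrite ?iter_succ //; lia.
Qed.

Lemma fwd_path_height u p : path fwd u p ->
  size p <= h u /\ {in p, forall v, h v < h u}.
Proof.
elim: p u => [|w p IH] u //= /andP[/h_lt uw /IH[le_p lt_p]]; split; first by lia.
move=> v; rewrite inE => /predU1P[-> //|/lt_p]; lia.
Qed.

(** * Tall case: cycles from two forward paths *)

Section BimonotoneCycles.

Variables penult ultim : V.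
Hypothesis ends_edge : e penult ultim.
Hypothesis ends_low : forall u, h u <= 1 -> u \in [:: penult; ultim].
Hypothesis two_children :
  forall u, 1 < h u -> exists v w, [/\ fwd u v, fwd u w & v != w].

Lemma other_child u b : 1 < h u -> exists2 c, fwd u c & c != b.
Proof.
case/two_children => v [w [uv uw vw]].
by have [v_b|] := eqVneq v b; [exists w; rewrite // -v_b eq_sym | exists v].
Qed.

(* Advancing the higher endpoint lowers the larger height by at most one: its
   best child is avoided only when that child is the other endpoint, whose
   height then becomes the maximum. *)
Lemma linking a b : a != b -> exists P Q,
  [/\ path fwd a P, path fwd b Q, uniq (a :: P ++ b :: Q),
      e (last a P) (last b Q) & maxn (h a) (h b) <= (size P + size Q).+1].
Proof.
have [m] := ubnP (h a + h b); elim: m a b => // m IH a b.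
wlog le_ba : a b / h b <= h a.
  move=> WL lt_m ab; have /orP[le_ba|le_ab] := leq_total (h b) (h a); first exact: WL.
  have [//||Q [P [eQ eP uQP ePQ le]]] := WL b a le_ab; rewrite 1?eq_sym //; first by lia.
  exists P, Q; split; rewrite // 1?maxnC 1?addnC // 1?e_sym //.
  by rewrite -cat_cons uniq_catC.
move=> lt_m ab; have [low|high] := leqP (h a) 1.
  exists [::], [::]; split; rewrite //= ?inE ?ab //; last by lia.
  have := ends_low (leq_trans le_ba low); have := ends_low low.
  move: ab; rewrite !inE => /[swap] /orP[]/eqP-> /[swap] /orP[]/eqP->;
    by rewrite ?eqxx // e_sym.
have [c [ac cb le_c]] : exists c, [/\ fwd a c, c != b & h a <= (maxn (h c) (h b)).+1].
  have [a_s ha] := succP (ltnW high).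
  have [s_b|sb] := eqVneq (succ a) b; last by exists (succ a); split=> //; lia.
  have [c ac cb] := other_child b high.
  by exists c; split=> //; rewrite -s_b; lia.
have lt_c := h_lt ac.
have [|//|P [Q [eP eQ uPQ ePQ le]]] := IH c b; first by lia.
exists (c :: P), Q; split=> //; [by rewrite /= ac| |by rewrite /=; lia].
(* [a] is new: vertices of [P] are lower than [c], those of [Q] lower than [b], and neither [c] nor
   [b] is higher than [a]. *)
rewrite cat_cons cons_uniq -cat_cons uPQ andbT; have [_ ltP] := fwd_path_height eP.
have [_ ltQ] := fwd_path_height eQ.
rewrite !inE mem_cat inE !negb_or ab; apply/and4P; split=> //.
- by apply: contraTneq lt_c => <-; rewrite ltnn.
- by apply/negP=> /ltP; lia.
- by apply/negP=> /ltQ; lia.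
Qed.

(** Apply [linking] to another child and [succ u], of height [h u - 1]. A path is never longer than
    the height of its start, whence the upper bound. *)
Lemma bimonotone_cycle u : 1 < h u ->
  exists2 l, h u < l <= (h u).*2.+1 & has_cycle_length e l.
Proof.
move=> high; have [us hu] := succP (ltnW high).
have [c uc cs] := other_child (succ u) high.
have [P [Q [eP eQ uPQ ePQ le]]] := linking cs.
have [szP ltP] := fwd_path_height eP; have [szQ ltQ] := fwd_path_height eQ.
have lt_c := h_lt uc; have lt_s := h_lt us.
have sub_path := sub_path fwd_edge.
exists (size (c :: P) + size (succ u :: Q)).+1; first by rewrite /=; lia.
apply: (@cycle_of_two_paths _ e u) => //.
- by apply: sub_path; rewrite /= uc.
- by apply: sub_path; rewrite /= us.
rewrite /= -[c :: _]/((c :: P) ++ succ u :: Q) in uPQ *.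
rewrite [(_ ++ _)]/= uPQ andbT; apply/negP.
rewrite inE mem_cat inE => /or4P[/eqP u_c|/ltP|/eqP u_s|/ltQ]; last 1 first.
- by lia.
- by rewrite -u_c ltnn in lt_c.
- by lia.
- by rewrite -u_s ltnn in lt_s.
Qed.

Lemma many_bimonotone_cycles root r :
  2 ^ r * 3 <= (h root).+1.*2 ->
  exists L, [/\ uniq L, size L = r, {in L, forall l, has_cycle_length e l} &
    {in L, forall l, l < 2 ^ r * 3}].
Proof.
elim: r => [|r IH] le_r; first by exists [::].
have p_gt0 : 0 < 2 ^ r by rewrite expn_gt0.
rewrite expnS in le_r *.
have [|L [uL szL cycL ltL]] := IH; first by lia.
(* The vertex of height [2 ^ r * 3 - 1] on the longest path from [root]; its cycle has length at
   least [2 ^ r * 3], beyond all of [L]. *)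
pose u := iter ((h root).+1 - 2 ^ r * 3) succ root.
have hu : (h u).+1 = 2 ^ r * 3 by rewrite /u iter_succ; lia.
have [|l lP cyc_l] := @bimonotone_cycle u; first by lia.
exists (l :: L); split=> /=.
- by rewrite uL andbT; apply/negP=> /ltL; lia.
- by rewrite szL.
- by move=> l' /predU1P[->|/cycL].
- by move=> l' /predU1P[->|/ltL]; lia.
Qed.

End BimonotoneCycles.

(** * Wide case: lenses bounded by longest paths *)

Section LensCycles.

Variables (lam : V -> nat) (par : V -> V) (top bottom : V) (k : nat).
Hypothesis lam_lt : forall u v, fwd u v -> lam u < lam v.
Hypothesis parP : forall v, 0 < lam v -> fwd (par v) v /\ lam v = (lam (par v)).+1.
Hypothesis lam_top : forall v, lam v = 0 -> v = top.
Hypothesis h_bottom : forall v, h v = 0 -> v = bottom.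
Hypothesis outdeg : forall u, #|[set v | fwd u v]| <= k.

Lemma height_depth_le v : h v + lam v <= h top.
Proof.
have [m] := ubnP (lam v); elim: m v => // m IH v lt_m.
have [lam0|pos] := posnP (lam v); first by rewrite lam0 addn0 (lam_top lam0).
have [/h_lt lt_h lamE] := parP pos.
by have := IH (par v); lia.
Qed.

Lemma iter_par i v : i <= lam v -> lam (iter i par v) = lam v - i.
Proof.
elim: i => [|i IH] lt_i; first by rewrite subn0.
have hi := IH (ltnW lt_i).
by have [] := @parP (iter i par v); rewrite hi /=; lia.
Qed.

Lemma iter_par_fwd i v : i < lam v -> fwd (iter i.+1 par v) (iter i par v).
Proof.
by move=> lt_i; have [] := @parP (iter i par v); rewrite ?iter_par //; lia.
Qed.

Lemma height_iter_par i v : i <= lam v -> h v + i <= h (iter i par v).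
Proof.
elim: i => [|i IH] lt_i; first by rewrite addn0.
by have := h_lt (iter_par_fwd lt_i); have := IH (ltnW lt_i); lia.
Qed.

(* Position [m] on the side through [y], counted from the [D]-th ancestor of [y];
   [y] itself sits at position [D]. *)
Definition lens_side D y m :=
  if m <= D then iter (D - m) par y else iter (m - D) succ y.

(* Recovers the position from the vertex alone, so that the two sides of a lens
   can only share vertices at equal positions. *)
Definition lens_level a c D v :=
  if c <= h v then lam v - (a - D) else D + (c - h v).

(** Going up from [y], [lam] drops by one per step while the height stays at least [h y]; going
    down, the height itself drops by one. Hence the height tells which half applies. *)
Lemma lens_side_level y D J m : D <= lam y -> J <= h y -> m <= D + J ->
  lens_level (lam y) (h y) D (lens_side D y m) = m.
Proof.
move=> le_D le_J le_m; rewrite /lens_side /lens_level.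
have [m_D|D_m] := leqP m D.
  have le_i : D - m <= lam y by lia.
  have := height_iter_par le_i; rewrite (iter_par le_i) => le_h.
  by have -> : h y <= h (iter (D - m) par y); lia.
have le_j : m - D <= h y by lia.
by rewrite (iter_succ le_j); have -> : (h y <= h y - (m - D)) = false; lia.
Qed.

Lemma lens_side_edge y D J m : D <= lam y -> J <= h y -> m < D + J ->
  e (lens_side D y m) (lens_side D y m.+1).
Proof.
move=> le_D le_J lt_m; apply: fwd_edge; rewrite /lens_side.
have [lt_mD|le_Dm] := ltnP m D.
  rewrite ltnW // -subnSK //; apply: iter_par_fwd; lia.
have [->|ltDm] := eqVneq m D.
  by rewrite leqnn subnn subSnn; apply: (@iter_succ_fwd 0); lia.
have -> : (m <= D) = false by lia.
by rewrite subSn //; apply: iter_succ_fwd; lia.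
Qed.

Lemma lens_cycle y z D J :
  lam y = lam z -> h y = h z -> D < lam y -> J < h y ->
  iter D.+1 par y = iter D.+1 par z -> iter D par y != iter D par z ->
  iter J.+1 succ y = iter J.+1 succ z -> iter J succ y != iter J succ z ->
  has_cycle_length e (D.+1 + J.+1).*2.
Proof.
move=> lamE hE le_D le_J parD neD succJ neJ.
pose A := lens_side D.+1 y; pose B := lens_side D.+1 z.
have levA m : m <= D.+1 + J.+1 -> lens_level (lam y) (h y) D.+1 (A m) = m.
  exact: lens_side_level.
have levB m : m <= D.+1 + J.+1 -> lens_level (lam y) (h y) D.+1 (B m) = m.
  by rewrite lamE hE; apply: lens_side_level; lia.
have AB0 : A 0 = B 0 by rewrite /A /B /lens_side.
have ABM : A (D.+1 + J.+1) = B (D.+1 + J.+1).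
  by rewrite /A /B /lens_side (_ : _ + _ <= _ = false) ?addKn //; lia.
(* Iterates that have met stay together, so the sides differ at every position strictly between the
   two ends. *)
have sep (s : V -> V) i j : i <= j -> iter j s y != iter j s z -> iter i s y != iter i s z.
  by move=> le_ij; apply: contraNneq => E; rewrite -(subnK le_ij) !iterD E.
have neAB m : 0 < m < D.+1 + J.+1 -> A m != B m.
  move=> lt_m; rewrite /A /B /lens_side; case: leqP => [le_m|lt_m'].
    by apply: sep neD; lia.
  by apply: sep neJ; lia.
have pathA m : m <= D.+1 + J.+1 -> path e (A 0) [seq A i | i <- iota 1 m].
  by move=> le_m; apply: path_map_iota => j lt_j; apply: (@lens_side_edge _ _ J.+1); lia.
have pathB m : m <= D.+1 + J.+1 -> path e (B 0) [seq B i | i <- iota 1 m].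
  by move=> le_m; apply: path_map_iota => j lt_j; apply: (@lens_side_edge _ _ J.+1); lia.
pose P := [seq A i | i <- iota 1 (D.+1 + J.+1)].
(* [Q] stops one position early: the common lower end belongs to [P], and the edge into it closes
   the cycle. *)
pose Q := [seq B i | i <- iota 1 (D.+1 + J)].
have -> : (D.+1 + J.+1).*2 = (size P + size Q).+1.
  by rewrite !size_map !size_iota; lia.
have lev_iota f m0 m : (forall i, i <= D.+1 + J.+1 -> lens_level (lam y) (h y) D.+1 (f i) = i) ->
    m0 + m <= (D.+1 + J.+1).+1 -> uniq [seq f i | i <- iota m0 m].
  move=> lev le_m; rewrite map_inj_in_uniq ?iota_uniq // => i j.
  rewrite !mem_iota => lt_i lt_j E.
  by rewrite -(lev i) ?E ?lev //; lia.
apply: (@cycle_of_two_paths _ e (A 0)) => //.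
- exact: pathA.
- by rewrite AB0; apply: pathB; lia.
- rewrite last_map_iota AB0 last_map_iota ABM add0n e_sym addnS.
  by apply: (@lens_side_edge _ _ J.+1); lia.
rewrite -cat_cons cat_uniq; apply/and3P; split.
- by rewrite -[_ :: _]/[seq A i | i <- iota 0 (D.+1 + J.+1).+1]; apply: lev_iota.
- apply/hasPn => v /mapP[j]; rewrite mem_iota => lt_j ->; apply/negP.
  rewrite -[_ :: _]/[seq A i | i <- iota 0 (D.+1 + J.+1).+1] => /mapP[i].
  rewrite mem_iota => lt_i E.
  have ij : i = j by rewrite -(levA i) -?E ?levB //; lia.
  by have := neAB j; rewrite E ij eqxx => /(_ _)/negP; apply; lia.
- by apply: lev_iota => //; lia.
Qed.

(* In [S] the length of a lens is twice the sum of two meeting times, each an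
   ultrametric. A pair separated as late as possible both by [par] and by [succ]
   gives the longest lens, and no pair within one branch of [par] attains it. *)
Lemma many_lens_cycles r a c D J (S : {set V}) :
  1 < k -> D <= a -> J <= c -> {in S, forall y, lam y = a /\ h y = c} ->
  {in S &, forall y z, iter D par y = iter D par z} ->
  {in S &, forall y z, iter J succ y = iter J succ z} ->
  k ^ r <= #|S| ->
  exists L, [/\ uniq L, size L = r, {in L, forall l, has_cycle_length e l} &
    {in L, forall l, l <= (D + J).*2}].
Proof.
move=> k_gt1; elim: r D J S => [|r IH] D J S le_D le_J ac parS succS le_S.
  by exists [::].
have k_gt0 := ltnW k_gt1.
have S_gt1 : 1 < #|S|.
  by apply: leq_trans le_S; rewrite expnS (leq_trans k_gt1) // leq_pmulr ?expn_gt0 ?k_gt0.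
have [D' [lt_D parD [u [v [Su Sv uv]]]]] := least_collapse S_gt1 parS.
have [J' [lt_J succJ [u' [v' [Su' Sv' uv']]]]] := least_collapse S_gt1 succS.
have [y [z [Sy Sz neD neJ]]] := jointly_separated Su Sv uv Su' Sv' uv'.
have [[lam_y h_y] [lam_z h_z]] := (ac y Sy, ac z Sz).
have [lt_Da lt_Jc] := (leq_trans lt_D le_D, leq_trans lt_J le_J).
have cyc : has_cycle_length e (D'.+1 + J'.+1).*2.
  by apply: (@lens_cycle y z); rewrite ?lam_y ?lam_z ?h_y ?h_z //;
    [apply: parD|apply: succJ].
have [w le_w] := large_fiber (iter D' par) (ltnW S_gt1).
set S' := [set _ in S | _] in le_w.
(* The [D']-th ancestors of [S] are all children of the single vertex [iter D'.+1 par y]. *)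
have branches : #|iter D' par @: S| <= k.
  apply: leq_trans (outdeg (iter D'.+1 par y)); apply/subset_leq_card/subsetP.
  move=> _ /imsetP[x Sx ->]; rewrite inE (parD y x) //.
  by apply: iter_par_fwd; rewrite (ac x Sx).1.
have S'S x : x \in S' -> x \in S by rewrite inE => /andP[].
(* Within the fibre all [D']-th ancestors agree, so the bound on lengths is two below the cycle just
   found. *)
have [//|||||L [uL szL cycL leL]] := IH D' J'.+1 S' (ltnW lt_Da).
- by move=> x /S'S /ac.
- by move=> x x'; rewrite !inE => /andP[_ /eqP->] /andP[_ /eqP->].
- by move=> x x' /S'S Sx /S'S Sx'; apply: succJ.
- rewrite -(leq_pmul2l k_gt0) -expnS (leq_trans le_S) // (leq_trans le_w) //.
  by rewrite leq_mul2r branches orbT.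
have lt_DJ : (D' + J'.+1).*2 < (D'.+1 + J'.+1).*2 by rewrite ltn_double.
have le_DJ : (D'.+1 + J'.+1).*2 <= (D + J).*2 by rewrite leq_double leq_add.
exists ((D'.+1 + J'.+1).*2 :: L); split=> /=.
- by rewrite uL andbT; apply/negP=> /leL; rewrite leqNgt lt_DJ.
- by rewrite szL.
- by move=> l /predU1P[->|/cycL].
- by move=> l /predU1P[-> //|/leL/leq_trans->] //; apply: leq_trans (ltnW lt_DJ) le_DJ.
Qed.

Lemma many_lens_of_class r a c (S : {set V}) :
  1 < k -> {in S, forall y, lam y = a /\ h y = c} -> k ^ r <= #|S| ->
  exists L, [/\ uniq L, size L = r & {in L, forall l, has_cycle_length e l}].
Proof.
move=> k_gt1 ac le_S.
have to_top y : y \in S -> iter a par y = top.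
  by move=> /ac[<- _]; apply: lam_top; rewrite iter_par ?subnn.
have to_bottom y : y \in S -> iter c succ y = bottom.
  by move=> /ac[_ <-]; apply: h_bottom; rewrite iter_succ ?subnn.
have [| |L [uL szL cycL _]] :=
    many_lens_cycles k_gt1 (leqnn a) (leqnn c) ac _ _ le_S; last by exists L.
- by move=> y z Sy Sz; rewrite !to_top.
- by move=> y z Sy Sz; rewrite !to_bottom.
Qed.

Lemma card_height_depth_class :
  exists a c, #|V| <= (h top).+1 ^ 2 * #|[set v | (lam v == a) && (h v == c)]|.
Proof.
have V_gt0 : 0 < #|[set: V]| by apply/card_gt0P; exists top.
pose f v : 'I_(h top).+1 * 'I_(h top).+1 := (inord (lam v), inord (h v)).
have [[a c] le_ac] := large_fiber f V_gt0.
exists (a : nat), (c : nat); rewrite cardsT in le_ac; apply: leq_trans le_ac _.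
apply: leq_mul; first by rewrite (leq_trans (max_card _)) // card_prod card_ord.
apply/subset_leq_card/subsetP => v; rewrite !inE /= => /eqP[<- <-].
by rewrite !inordK ?eqxx // ltnS (leq_trans _ (height_depth_le v)) ?leq_addl ?leq_addr.
Qed.

End LensCycles.

End HeightedDigraph.

(** * Counting vertices and combining the two cases *)

(** [H.+1 <= 2 ^ t * 3] gives [H.+1 ^ 2 <= 4 ^ t * 9 <= 8 ^ (t + 2)], a coarse bound chosen to make
    the product a power of [8 * k]. *)
Lemma order_bound H N s k t1 t2 :
  2 < k -> N <= H.+1 ^ 2 * s -> H.+1.*2 < 2 ^ t1.+1 * 3 -> s < k ^ t2.+1 ->
  N <= (8 * k) ^ (maxn t1 t2 + 2).
Proof.
move=> k_gt2 le_N lt_H lt_s; set t := maxn t1 t2.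
have le_H : H.+1 <= 2 ^ t * 3.
  have: 2 ^ t1 <= 2 ^ t by rewrite leq_exp2l ?leq_maxl.
  by rewrite expnS in lt_H; lia.
have le_s : s <= k ^ t.+1.
  by rewrite (leq_trans (ltnW lt_s)) // leq_exp2l ?ltnS ?leq_maxr //; lia.
have le_H2 : H.+1 ^ 2 <= 4 ^ t * 9.
  by rewrite (leq_trans (n := (2 ^ t * 3) ^ 2)) ?leq_exp2r // expnMn expnAC.
have le_84 : 4 ^ t <= 8 ^ t by case: (t) => // m; rewrite leq_exp2r.
have le_k : k ^ t.+1 <= k ^ (t + 2) by rewrite leq_exp2l; lia.
rewrite (leq_trans le_N) // (leq_trans (leq_mul le_H2 le_s)) // expnMn leq_mul //.
by rewrite expnD leq_mul.
Qed.

Lemma many_cycle_lengths (n k : nat) (e : rel 'I_n) (top penult ultim : 'I_n) :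
  let fwd i j := e i j && (i < j) in
  symmetric e -> 2 < k ->
  fwd penult ultim -> (forall j, fwd penult j -> j = ultim) ->
  (forall j, ~~ fwd ultim j) ->
  (forall j, j != top -> exists i, fwd i j) ->
  (forall i, i \notin [:: penult; ultim] -> 1 < #|[set j | fwd i j]|) ->
  (forall i, #|[set j | fwd i j]| <= k) ->
  exists L, [/\ uniq L, {in L, forall l, has_cycle_length e l} &
    n <= (8 * k) ^ (size L + 2)].
Proof.
move=> fwd e_sym k_gt2 pu pu_only u_none parent two outdeg.
have fwd_edge i j : fwd i j -> e i j by case/andP.
have [|h [succ [h_lt succP]]] := @exists_height _ fwd (fun i => n - i).
  by move=> i j /andP[_ ij]; rewrite ltn_sub2l // (ltn_trans ij).
have [|lam [par [lam_gt parP]]] := @exists_height _ (fun i j => fwd j i) (@nat_of_ord n).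
  by move=> i j /andP[].
have lam_lt i j : fwd i j -> lam i < lam j by apply: lam_gt.
have children i : i \notin [:: penult; ultim] ->
    exists j j', [/\ fwd i j, fwd i j' & j != j'].
  by move/two/card_gt1P=> [j [j' []]]; rewrite !inE => ? ? ?; exists j, j'.
have lam_top j : lam j = 0 -> j = top.
  by move=> lam0; have [//|/parent[i /lam_lt]] := eqVneq j top; rewrite lam0.
have h_ultim i : h i = 0 -> i = ultim.
  move=> h0; have [i_end|/children[j [j' [/h_lt]]]] := boolP (i \in [:: penult; ultim]);
    last by rewrite h0.
  move: i_end; rewrite !inE => /orP[]/eqP i_end //.
  by have := h_lt _ _ pu; rewrite -i_end h0.
(* Any other vertex has two distinct children; only [ultim] can have height 0, so one child has
   positive height. *)
have ends_low i : h i <= 1 -> i \in [:: penult; ultim].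
  apply: contraTT => /children[j [j' [ij ij' jj']]]; rewrite -ltnNge.
  have [hj|hj] := posnP (h j); last exact: leq_ltn_trans (h_lt _ _ ij).
  have [hj'|hj'] := posnP (h j'); last exact: leq_ltn_trans (h_lt _ _ ij').
  by rewrite (h_ultim _ hj) (h_ultim _ hj') eqxx in jj'.
have hu0 : h ultim = 0.
  by have [//|/succP[]] := posnP (h ultim); rewrite (negPf (u_none _)).
have hp1 : h penult = 1.
  have [fs ->] := succP _ (leq_ltn_trans (leq0n _) (h_lt _ _ pu)).
  by rewrite (pu_only _ fs) hu0.
have two_children i : 1 < h i -> exists j j', [/\ fwd i j, fwd i j' & j != j'].
  by move=> high; apply: children; apply: contraTN high; rewrite !inE
    => /orP[]/eqP->; rewrite ?hu0 ?hp1.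
have top_gt0 : 0 < h top.
  have := height_depth_le h_lt parP lam_top penult.
  by apply: leq_trans; rewrite hp1.
have [a [c le_n]] := card_height_depth_class h_lt parP lam_top.
set S := [set _ | _] in le_n; rewrite card_ord in le_n.
have S_gt0 : 0 < #|S|.
  rewrite lt0n; apply: contraTneq le_n => ->.
  by rewrite muln0 -ltnNge (leq_ltn_trans _ (ltn_ord top)).
(* [t1] and [t2] are the largest exponents the two cases admit. Failure of their successors bounds
   [n], and the case with the larger exponent supplies [L]. *)
pose t1 := trunc_log 2 ((h top).+1.*2 %/ 3).
pose t2 := trunc_log k #|S|.
have /andP[t1_le t1_gt] : 2 ^ t1 <= (h top).+1.*2 %/ 3 < 2 ^ t1.+1.
  by apply: trunc_log_bounds; rewrite // divn_gt0 // doubleS !ltnS double_gt0.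
have /andP[t2_le t2_gt] : k ^ t2 <= #|S| < k ^ t2.+1.
  by apply: trunc_log_bounds; rewrite // ltnW.
rewrite leq_divRL // in t1_le; rewrite ltn_divLR // in t1_gt.
have bound := order_bound k_gt2 le_n t1_gt t2_gt.
have [le_t|/ltnW le_t] := leqP t2 t1.
  have [L [uL szL cycL _]] := many_bimonotone_cycles e_sym fwd_edge h_lt succP
    (fwd_edge _ _ pu) ends_low two_children t1_le.
  by exists L; split; rewrite // szL -(maxn_idPl le_t).
have [|L [uL szL cycL]] := @many_lens_of_class _ e fwd h succ e_sym fwd_edge h_lt
  succP lam par top ultim k parP lam_top h_ultim outdeg t2 a c S (ltnW k_gt2) _ t2_le.
  by move=> y; rewrite inE => /andP[/eqP-> /eqP->].
by exists L; split; rewrite // szL -(maxn_idPr le_t).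
Qed.

(** * Transfer to ordered graphs and passage to logarithms *)

Theorem theorem4p2 (R : realType) (k n : nat) (V : finType) (e : rel V)
    (x : 'I_n -> V) :
  3 <= k -> k + 1 <= n ->
  symmetric e -> irreflexive e -> bijective x -> k_ordered e x k ->
  exists L : seq nat,
    [/\ uniq L,
        (forall l, l \in L -> has_cycle_length e l) &
        (log2 n%:R / (3 + log2 k%:R) - 2 <= (size L)%:R :> R)%R].
Proof.
move=> k_gt2 n_gt e_sym _ x_bij [[p [u [pE uE epu]]] dplusP dminusP].
have x_inj := bij_inj x_bij.
have n_gt0 : 0 < n by lia.
pose e' i j := e (x i) (x j).
have dplusE i : dplus e x i = #|[set j | e' i j && (i < j)]|.
  by rewrite /dplus card_imset //; apply: eq_card => j; rewrite !inE.
have lift l : has_cycle_length e' l -> has_cycle_length e l.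
  case=> s [/andP[cs us] s_ge3 <-]; exists (map x s); rewrite size_map; split=> //.
  apply/andP; split; last by rewrite map_inj_uniq.
  by case: s cs {us s_ge3} => //= i s; rewrite -map_rcons path_map.
have [|||||||L [uL cycL le_n]] :=
  @many_cycle_lengths n k e' (Ordinal n_gt0) p u _ k_gt2.
- by move=> i j; rewrite /e' e_sym.
- by rewrite /e' epu; lia.
- by move=> j /andP[_ pj]; apply: val_inj => /=; have := ltn_ord j; lia.
- by move=> j; rewrite negb_and -leqNgt; apply/orP; right; have := ltn_ord j; lia.
- move=> j j0; have j_gt0 : 0 < j.
    by rewrite lt0n; apply: contraNneq j0 => j0; apply/eqP/val_inj.
  have /card_gt0P[w /imsetP[i]] := dminusP j j_gt0.
  by rewrite inE => /andP[eji ij] _; exists i; rewrite /e' e_sym eji.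
- move=> i; rewrite !inE negb_or => /andP[ip iu].
  have lt_i : i.+2 < n; last by case/andP: (dplusP i lt_i); rewrite dplusE.
  by move: ip iu; rewrite -!val_eqE /=; have := ltn_ord i; lia.
- move=> i; have [lt_i|le_i] := ltnP i.+2 n.
    by rewrite -dplusE; case/andP: (dplusP i lt_i).
  apply: (@leq_trans #|[set u]|); last by rewrite cards1; lia.
  apply/subset_leq_card/subsetP => j; rewrite !inE => /andP[_ ij].
  by rewrite -val_eqE /=; have := ltn_ord j; lia.
exists L; split=> // [l /cycL /lift //|].
have ln2_gt0 : (0 < ln 2 :> R)%R by rewrite ln_gt0 // ltr1n.
have lnk_gt0 : (0 < ln k%:R :> R)%R by rewrite ln_gt0 // ltr1n; lia.
rewrite lerBlDr ler_pdivrMr; last first.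
  by rewrite addr_gt0 // divr_gt0.
have k_gt0 : (0 < k%:R :> R)%R by rewrite ltr0n; lia.
(* [3 + log2 k] is the binary logarithm of [8 * k], so the claim reduces to
   [n <= (8 * k) ^ (size L + 2)]. *)
have ln8k : (ln (8 * k)%:R = ln 2 * (3 + log2 k%:R) :> R)%R.
  rewrite natrM lnM ?posrE // (_ : 8%:R = 2 ^+ 3 :> R)%R; last by rewrite -natrX.
  by rewrite lnXn // /log2 mulrDr mulrCA divff ?gt_eqF // mulr1 mulr_natr.
rewrite {1}/log2 ler_pdivrMr // -mulrA [(_ * ln 2)%R]mulrC -ln8k.
rewrite -natrD mulr_natl -lnXn; last by rewrite ltr0n; lia.
by rewrite ler_ln ?posrE -?natrX ?ler_nat ?ltr0n ?expn_gt0 //; lia.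
Qed.
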